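(* The compact finite difference scheme given in the context is uniquely solvable; that is, there exists exactly one pair of $M$-periodic (in $i$) grid functions $\{u_i^k\},\{v_i^k\}$, $0\le k\le N$, satisfying it.
   Context: Parameters: $\mu$ and $\gamma$ are non-negative constants, $\kappa$ and $\nu$ are (real) parameters, $L$ is the spatial period, $(0,T]$ is the time interval, and $\varphi:\mathbb R\to\mathbb R$ is an $L$-periodic function. $M,N$ are positive integers, $h=L/M$, $\tau=T/N$, $x_i=ih$ ($i\in\mathbb Z$), $t_k=k\tau$. Notation for grid functions: $\delta_x^2u_i=\frac1{h^2}(u_{i+1}-2u_i+u_{i-1})$, $\Delta_xu_i=\frac1{2h}(u_{i+1}-u_{i-1})$, $u^{k+1/2}=\frac12(u^k+u^{k+1})$, $u^{\bar k}=\frac12(u^{k-1}+u^{k+1})$, $\delta_tu^{k+1/2}=\frac1\tau(u^{k+1}-u^k)$, $\Delta_tu^k=\frac1{2\tau}(u^{k+1}-u^{k-1})$, $\psi(u,v)_i=\frac13[u_i\Delta_xv_i+\Delta_x(uv)_i]$. Compact difference scheme (for the equation $u_t-\mu u_{xxt}+\gamma uu_x+\kappa u_x-\nu u_{xx}=0$ with $L$-periodic boundary condition and initial value $\varphi$). Grid functions $u_i^k,v_i^k$ ($0\le k\le N$), $M$-periodic in $i$ ($u_{i+M}^k=u_i^k$, $v_{i+M}^k=v_i^k$), with $u_i^0=\varphi(x_i)$ and, for $1\le i\le M$: (1) $\delta_tu_i^{1/2}-\mu\delta_tv_i^{1/2}+\gamma\big[\psi(u^0,u^{1/2})_i-\frac{h^2}2\psi(v^0,u^{1/2})_i\big]+\kappa\big(\Delta_xu_i^{1/2}-\frac{h^2}6\Delta_xv_i^{1/2}\big)-\nu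 v_i^{1/2}=0$; (2) $\Delta_tu_i^k-\mu\Delta_tv_i^k+\gamma\big[\psi(u^k,u^{\bar k})_i-\frac{h^2}2\psi(v^k,u^{\bar k})_i\big]+\kappa\big(\Delta_xu_i^{\bar k}-\frac{h^2}6\Delta_xv_i^{\bar k}\big)-\nu v_i^{\bar k}=0$ for $1\le k\le N-1$; (3) $v_i^k=\delta_x^2u_i^k-\frac{h^2}{12}\delta_x^2v_i^k$ for $0\le k\le N$.
   Formalization: The formal theorem adds the assumption μ + ντ + h²/6 > 0 (automatic for ν ≥ 0); for arbitrary real ν uniqueness fails, e.g. M=2, N=1, L=2, T=1, μ=γ=κ=0, φ=0, ν=−1/3. *)

(* Defs.v *)
From mathcomp Require Import all_boot all_order all_algebra.
From mathcomp Require Import reals.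

Set Implicit Arguments.
Unset Strict Implicit.
Unset Printing Implicit Defensive.

Import Order.TTheory GRing.Theory Num.Theory.
Local Open Scope ring_scope.

Section GridOperators.
Context {R : realType}.
Implicit Types (h tau : R) (u v : int -> R) (i : int).

Definition periodic_grid (M : nat) u := forall i, u (i + M%:Z) = u i.

Definition delta2_x h u i : R := (u (i + 1) - 2 * u i + u (i - 1)) / h ^+ 2.

Definition Delta_x h u i : R := (u (i + 1) - u (i - 1)) / (2 * h).

Definition psi h u v i : R :=
  3^-1 * (u i * Delta_x h v i + Delta_x h (fun j => u j * v j) i).

(* Time levels are the elements of 'I_N.+1.  The operators below take the level
   as a natural number k; they are meaningful when all the levels they mention
   are at most N, in which case [inord] is exact. *)
Section Time.
Context {N : nat}.
Implicit Types (w : 'I_N.+1 -> int -> R) (k : nat).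

Definition avg_half w k : int -> R :=
  fun i => (w (inord k) i + w (inord k.+1) i) / 2.

Definition avg_bar w k : int -> R :=
  fun i => (w (inord k.-1) i + w (inord k.+1) i) / 2.

(* The difference quotient at level k + 1/2. *)
Definition delta_t tau w k : int -> R :=
  fun i => (w (inord k.+1) i - w (inord k) i) / tau.

Definition Delta_t tau w k : int -> R :=
  fun i => (w (inord k.+1) i - w (inord k.-1) i) / (2 * tau).

End Time.
End GridOperators.

Definition mesh_size {R : realType} (L : R) (M : nat) : R := L / M%:R.
Definition time_step {R : realType} (T : R) (N : nat) : R := T / N%:R.

(* Compact scheme for
     u_t - mu u_xxt + gamma u u_x + kappa u_x - nu u_xx = 0
   with L-periodic boundary condition and initial value phi; v stands for the
   fourth-order compact approximation of u_xx. *)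
Record compact_scheme {R : realType} (mu gamma kappa nu L T : R)
    (phi : R -> R) (M N : nat) (u v : 'I_N.+1 -> int -> R) : Prop :=
  CompactScheme {
    scheme_periodic_u : forall k, periodic_grid M (u k);
    scheme_periodic_v : forall k, periodic_grid M (v k);
    scheme_initial : forall i : int, u ord0 i = phi (i%:~R * mesh_size L M);
    scheme_first_step :
      let h := mesh_size L M in let tau := time_step T N in
      forall i : int, 1 <= i <= M%:Z ->
      delta_t tau u 0 i - mu * delta_t tau v 0 i
      + gamma * (psi h (u ord0) (avg_half u 0) i
                 - h ^+ 2 / 2 * psi h (v ord0) (avg_half u 0) i)
      + kappa * (Delta_x h (avg_half u 0) i
                 - h ^+ 2 / 6 * Delta_x h (avg_half v 0) i)
      - nu * avg_half v 0 i = 0;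
    scheme_step :
      let h := mesh_size L M in let tau := time_step T N in
      forall (k : nat) (i : int), (1 <= k <= N.-1)%N -> 1 <= i <= M%:Z ->
      Delta_t tau u k i - mu * Delta_t tau v k i
      + gamma * (psi h (u (inord k)) (avg_bar u k) i
                 - h ^+ 2 / 2 * psi h (v (inord k)) (avg_bar u k) i)
      + kappa * (Delta_x h (avg_bar u k) i
                 - h ^+ 2 / 6 * Delta_x h (avg_bar v k) i)
      - nu * avg_bar v k i = 0;
    scheme_compact :
      let h := mesh_size L M in
      forall (k : 'I_N.+1) (i : int), 1 <= i <= M%:Z ->
      v k i = delta2_x h (u k) i - h ^+ 2 / 12 * delta2_x h (v k) i
  }.

(* Automatic when nu >= 0.  For nu < 0 some bound is unavoidable: the operator
   - delta2_x / (1 + h^2/12 delta2_x) has largest eigenvalue 6 / h^2 when M is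
   even, so for gamma = kappa = 0 and N >= 2 the linear system of the
   three-level step is singular as soon as mu + nu tau + h^2 / 6 = 0. *)
Definition admissible_viscosity {R : realType} (mu nu h tau : R) : Prop :=
  0 < mu + nu * tau + h ^+ 2 / 6.

Lemma admissible_viscosity_ge0 (R : realType) (mu nu h tau : R) :
  0 <= mu -> 0 <= nu -> 0 < h -> 0 < tau -> admissible_viscosity mu nu h tau.
Proof.
move=> mu0 nu0 h0 tau0; apply: ltr_wpDl.
  by rewrite addr_ge0 // mulr_ge0 // ltW.
by rewrite divr_gt0 // exprn_gt0.
Qed.

(* Main.v *)
(** Each time level is obtained from the previous ones by solving a linear system
    on M-periodic grid functions, so it suffices to show that its homogeneous
    version has only the zero solution.  Write A = 1 + (h^2/12) delta2_x.  This
    operator is injective, hence bijective on periodic functions, so a pair (a, b)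
    satisfies the compact relation b = delta2_x a - (h^2/12) delta2_x b exactly
    when a = A c and b = delta2_x c for some periodic c, and c is the unknown.
    Pairing the homogeneous system with a, the psi and Delta_x terms vanish by
    skew-symmetry and there remains
      r (|a|^2 + (mu + nu / r) (- <b, a>)) = 0,  with r = 1/tau or 2/tau.
    Since 0 <= (h^2/6) (- <b, a>) <= |a|^2, admissibility gives a = 0, so c = 0. *)
Require Import Defs.
From HB Require Import structures.
From mathcomp Require Import all_boot all_order all_algebra.
From mathcomp Require Import boolp reals.
From mathcomp Require Import ring lra zify.

Set Implicit Arguments.
Unset Strict Implicit.
Unset Printing Implicit Defensive.

Import Order.TTheory GRing.Theory Num.Theory.
Local Open Scope ring_scope.

(** * Periodic grid functions and sums over one period *)

Section PeriodicGrid.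
Variables (R : realType) (M : nat).
Implicit Types (f g : int -> R) (i : int).

Lemma periodic_gridZ f n i : periodic_grid M f -> f (i + n * M%:Z) = f i.
Proof.
move=> pf; elim/int_ind: n => [|n IH|n IH]; first by rewrite mul0r addr0.
  by rewrite -addn1 PoszD mulrDl mul1r addrA pf.
by rewrite -[RHS]IH -pf -addn1 PoszD; congr f; ring.
Qed.

Lemma periodic_grid_modz f i : periodic_grid M f -> f (i %% M%:Z)%Z = f i.
Proof.
by move=> pf; rewrite [in RHS](divz_eq i M) addrC periodic_gridZ.
Qed.

Lemma periodic_grid_eq f g : (0 < M)%N -> periodic_grid M f ->
  periodic_grid M g -> (forall i, 1 <= i <= M%:Z -> f i = g i) -> f =1 g.
Proof.
move=> M0 pf pg fg i.
have M0' : M%:Z != 0 by rewrite eqz_nat -lt0n.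
(* Reducing [i - 1] modulo [M] and adding 1 back gives the representative in 1..M rather than
   0..M-1. *)
rewrite -[i](subrK 1) -(periodic_gridZ (- ((i - 1) %/ M)%Z) _ pf).
rewrite -(periodic_gridZ (- ((i - 1) %/ M)%Z) _ pg).
apply: fg; have := modz_ge0 (i - 1) M0'; have := ltz_pmod (i - 1) (_ : 0 < M%:Z).
by have := divz_eq (i - 1) M; lia.
Qed.

Definition period_sum f : R := \sum_(i < M) f i%:Z.

Lemma period_sum_telescope f g : periodic_grid M g ->
  (forall i, f i = g (i + 1) - g i) -> period_sum f = 0.
Proof.
move=> pg fg; rewrite /period_sum -(big_mkord xpredT (fun i : nat => f i)).
rewrite (eq_bigr (fun i : nat => g i.+1%:Z - g i%:Z)); last first.
  by move=> i _; rewrite fg -addn1 PoszD.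
rewrite (telescope_sumr (fun i : nat => g i)) //.
by rewrite -[M%:Z]add0r pg subrr.
Qed.

(** Certificate form of summation by parts: [s] is a nonnegative density, [g] a periodic flux whose
    differences cancel over a period. *)
Lemma period_sum_ge0 f g s : periodic_grid M g -> (forall i, 0 <= s i) ->
  (forall i, f i = s i + (g (i + 1) - g i)) -> 0 <= period_sum f.
Proof.
move=> pg s0 fg; suff -> : period_sum f = period_sum s by exact: sumr_ge0.
have := period_sum_telescope pg (fun _ => erefl); rewrite /period_sum => z.
by under eq_bigr do rewrite fg; rewrite big_split /= z addr0.
Qed.

Lemma period_sum_sqr_eq0 f : (0 < M)%N -> periodic_grid M f ->
  period_sum (fun i => f i ^+ 2) <= 0 -> forall i, f i = 0.
Proof.
move=> M0 pf s0 i; have M0' : M%:Z != 0 by rewrite eqz_nat -lt0n.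
rewrite -periodic_grid_modz //.
have := modz_ge0 i M0'; have := ltz_pmod i (_ : 0 < M%:Z).
case: (i %% M)%Z => // n /(_ M0); rewrite ltz_nat => nM _.
have /psumr_eq0P : \sum_(i < M) f i ^+ 2 = 0.
  by apply/eqP; rewrite eq_le s0 sumr_ge0 // => j _; exact: sqr_ge0.
move=> /(_ (fun j _ => sqr_ge0 _)) /(_ (Ordinal nM) isT) /eqP.
by rewrite sqrf_eq0 => /eqP.
Qed.

End PeriodicGrid.

(** Periodic functions form a space of dimension [M], so an injective linear endomorphism is onto;
    row vectors of values over one period carry the matrix argument. *)
Lemma periodic_solve (R : realType) (M : nat) (F : (int -> R) -> int -> R) :
  (0 < M)%N ->
  (forall a f g i, F (fun j => a * f j + g j) i = a * F f i + F g i) ->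
  (forall f, periodic_grid M f -> periodic_grid M (F f)) ->
  (forall f, periodic_grid M f -> F f =1 (fun=> 0) -> f =1 (fun=> 0)) ->
  forall g, periodic_grid M g -> exists2 f, periodic_grid M f & F f =1 g.
Proof.
case: M => // m _ Flin Fper Finj g pg.
pose ext (x : 'rV[R]_m.+1) (i : int) := x 0 (inord `|(i %% m.+1)%Z|).
have pext x : periodic_grid m.+1 (ext x) by move=> i; rewrite /ext modzDr.
have extE x (j : 'I_m.+1) : ext x j = x 0 j.
  by rewrite /ext modz_small ?ltz_nat ?ltn_ord //= inord_val.
have ext_eq f h : periodic_grid m.+1 f -> periodic_grid m.+1 h ->
    (forall j : 'I_m.+1, f j = h j) -> f =1 h.
  move=> pf ph fh i; have m0 : m.+1%:Z != 0 by [].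
  rewrite -(periodic_grid_modz _ pf) -(periodic_grid_modz _ ph).
  have := modz_ge0 i m0; have := ltz_pmod i (_ : 0 < m.+1%:Z).
  case: (i %% _)%Z => // n /(_ isT); rewrite ltz_nat => nM _.
  exact: (fh (Ordinal nM)).
pose phi (x : 'rV[R]_m.+1) : 'rV[R]_m.+1 := \row_j F (ext x) j.
have phi_lin : linear phi.
  move=> a x y; apply/rowP => j; rewrite !mxE -Flin; congr (F _ _).
  by apply/funext => i; rewrite /ext !mxE.
pose phiL : {linear 'rV[R]_m.+1 -> 'rV[R]_m.+1} :=
  HB.pack phi (GRing.isLinear.Build _ _ _ _ phi phi_lin).
have free : row_free (lin1_mx phiL).
  apply: inj_row_free => x; rewrite mul_rV_lin1 => /rowP x0.
  apply/rowP => j; rewrite -extE mxE; apply: Finj => //.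
  apply: ext_eq => // [|k]; first exact: Fper.
  by have := x0 k; rewrite !mxE.
rewrite row_free_unit in free.
pose x := (\row_j g j%:Z) *m invmx (lin1_mx phiL) : 'rV[R]_m.+1.
exists (ext x); first exact: pext.
apply: ext_eq => // [|j]; first exact: Fper.
have := congr1 (fun y : 'rV_m.+1 => y 0 j) (mulmxKV free (\row_j g j%:Z)).
by rewrite mul_rV_lin1 !mxE.
Qed.

Ltac periodic M :=
  let i := fresh "i" in
  move=> i; rewrite /= ?/psi ?/Delta_x ?/delta2_x /= !(addrAC _ M%:Z);
  repeat match goal with pf : periodic_grid M _ |- _ => rewrite !pf end.

Ltac unshift := rewrite ?addrK ?subrK.

(** * Skew-symmetry, energy bounds and the compact operator *)

Section SummationByParts.
Variables (R : realType) (M : nat) (h : R).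
Hypothesis h_gt0 : 0 < h.
Implicit Types (u f c : int -> R).

Local Notation sum := (period_sum M).

Let h_neq0 : h != 0. Proof. exact: lt0r_neq0. Qed.

Lemma Delta_x_skew f : periodic_grid M f ->
  sum (fun i => f i * Delta_x h f i) = 0.
Proof.
move=> pf; apply: (@period_sum_telescope _ _ _
  (fun i => f i * f (i - 1) / (2 * h))) => [|i]; first by periodic M.
by rewrite /Delta_x; unshift; field.
Qed.

(** The two halves of [psi] add up to the difference of a flux weighted by u_i + u_{i-1}. *)
Lemma psi_skew u f : periodic_grid M u -> periodic_grid M f ->
  sum (fun i => f i * psi h u f i) = 0.
Proof.
move=> pu pf; apply: (@period_sum_telescope _ _ _
  (fun i => (u i + u (i - 1)) * f i * f (i - 1) / (6 * h))) => [|i].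
  by periodic M.
by rewrite /psi /Delta_x; unshift; field.
Qed.

(** [Delta_x] is skew and commutes with the symmetric [delta2_x], so the composition is skew. *)
Lemma Delta_x_delta2_x_skew c : periodic_grid M c ->
  sum (fun i => c i * Delta_x h (delta2_x h c) i) = 0.
Proof.
move=> pc; apply: (@period_sum_telescope _ _ _
  (fun i => (c (i + 1) * c (i - 1) + c i * c (i - 1 - 1)
             - 2 * c i * c (i - 1)) / (2 * h ^+ 3))) => [|i].
  by periodic M.
by rewrite /Delta_x /delta2_x; unshift; field.
Qed.

Lemma psi_linear u k f c i :
  psi h u (fun j => k * f j + c j) i = k * psi h u f i + psi h u c i.
Proof. by rewrite /psi /Delta_x; field. Qed.

(** The three-point average with weights 1/12, 10/12, 1/12. *)
Definition compact_avg c i : R := c i + h ^+ 2 / 12 * delta2_x h c i.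

Definition is_compact f c : Prop :=
  forall i, c i = delta2_x h f i - h ^+ 2 / 12 * delta2_x h c i.

Lemma periodic_delta2_x c : periodic_grid M c -> periodic_grid M (delta2_x h c).
Proof. by move=> pc; periodic M. Qed.

Lemma periodic_compact_avg c :
  periodic_grid M c -> periodic_grid M (compact_avg c).
Proof. by move=> pc i; rewrite /compact_avg periodic_delta2_x ?pc. Qed.

Hypothesis M_gt0 : (0 < M)%N.

(** In the kernel, c_{i-1} + 10 c_i + c_{i+1} = 0, which turns the sum of (c_i + c_{i+1})^2 into -8
    times the sum of c_i^2. *)
Lemma compact_avg_inj c : periodic_grid M c ->
  compact_avg c =1 (fun=> 0) -> c =1 (fun=> 0).
Proof.
move=> pc Ac0; apply: (period_sum_sqr_eq0 M_gt0 pc).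
rewrite -oppr_ge0 /period_sum -sumrN.
apply: (@period_sum_ge0 _ _ (fun i => - c i ^+ 2)
  (fun i => - (c i ^+ 2 + c i * c (i - 1)) / 8)
  (fun i => (c i + c (i + 1)) ^+ 2 / 8)) => [|i|i]; first by periodic M.
  by rewrite divr_ge0 ?sqr_ge0.
have -> : c (i + 1) = - 10 * c i - c (i - 1).
  have := Ac0 i; rewrite /compact_avg /delta2_x => e.
  apply/eqP; rewrite -subr_eq0; apply/eqP.
  by rewrite -[RHS](mulr0 12) -[X in _ = _ * X]e; field.
by unshift; field.
Qed.

(* With [a] the compact average of [c] and [b = delta2_x c]: the eigenvalues of
   the map taking [a] to [- b] lie between [0] and [6 / h ^+ 2]. *)
Lemma energy_ge0 c : periodic_grid M c ->
  0 <= sum (fun i => - (delta2_x h c i * compact_avg c i)).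
Proof.
(* With b = [delta2_x h c], summation by parts gives - <b, c> = |Delta_x c|^2 + (h^2/4) |b|^2; the
   coefficient 1/6 is 1/4 - 1/12. *)
move=> pc; apply: (@period_sum_ge0 _ _ _
  (fun i => (c (i - 1) ^+ 2 - c i ^+ 2) / (2 * h ^+ 2))
  (fun i => (h * delta2_x h c i) ^+ 2 / 6 +
            ((c (i + 1) - c (i - 1)) / (2 * h)) ^+ 2)) => [|i|i].
- by periodic M.
- by rewrite addr_ge0 ?divr_ge0 ?sqr_ge0.
- by rewrite /compact_avg /delta2_x; unshift; field.
Qed.

Lemma energy_le c : periodic_grid M c ->
  h ^+ 2 / 6 * sum (fun i => - (delta2_x h c i * compact_avg c i))
  <= sum (fun i => compact_avg c i ^+ 2).
Proof.
move=> pc; rewrite -subr_ge0 /period_sum mulr_sumr -sumrB.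
(* The summand is (c + (h^2/12) b)(c + (h^2/4) b). Taking out (c + (h^2/4) b)^2 leaves -(h^2/6) b (c
   + (h^2/4) b), which sums to (h^2/6) |Delta_x c|^2. *)
apply: (@period_sum_ge0 _ _ (fun i => compact_avg c i ^+ 2
    - h ^+ 2 / 6 * - (delta2_x h c i * compact_avg c i))
  (fun i => (c (i - 1) ^+ 2 - c i ^+ 2) / 12)
  (fun i => (c i + h ^+ 2 / 4 * delta2_x h c i) ^+ 2 +
            (c (i + 1) - c (i - 1)) ^+ 2 / 24)) => [|i|i].
- by periodic M.
- by rewrite addr_ge0 ?divr_ge0 ?sqr_ge0.
- by rewrite /compact_avg /delta2_x; unshift; field.
Qed.

Lemma energy_definite s c : periodic_grid M c -> 0 < s + h ^+ 2 / 6 ->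
  sum (fun i => compact_avg c i ^+ 2)
  + s * sum (fun i => - (delta2_x h c i * compact_avg c i)) <= 0 ->
  c =1 (fun=> 0).
Proof.
move=> pc s_gt E_le0; apply: compact_avg_inj => //.
apply: (period_sum_sqr_eq0 M_gt0); first exact: periodic_compact_avg.
have := energy_le pc; have := energy_ge0 pc; move: E_le0.
set A := sum _; set B := sum _ => E_le0 B_ge0 AB.
have sB : 0 <= (s + h ^+ 2 / 6) * B by rewrite mulr_ge0 // ltW.
(* By [AB], (s + h^2/6) B <= A + s B <= 0; so B = 0, and then A <= 0. *)
have B0 : B <= 0 by nra.
nra.
Qed.

Lemma compact_avg_is_compact c : is_compact (compact_avg c) (delta2_x h c).
Proof. by move=> i; rewrite /compact_avg /delta2_x; field. Qed.

Lemma compact_avg_linear k f c i : compact_avg (fun j => k * f j + c j) i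
  = k * compact_avg f i + compact_avg c i.
Proof. by rewrite /compact_avg /delta2_x; field. Qed.

Lemma compact_avg_solve f : periodic_grid M f ->
  exists2 c, periodic_grid M c & f = compact_avg c.
Proof.
move=> pf; have [c pc /funext cE] := periodic_solve M_gt0 compact_avg_linear
  periodic_compact_avg compact_avg_inj pf.
by exists c.
Qed.

Lemma is_compact_unique f c c' : periodic_grid M c -> periodic_grid M c' ->
  is_compact f c -> is_compact f c' -> c = c'.
Proof.
move=> pc pc' fc fc'.
have d0 : (fun i => -1 * c' i + c i) =1 (fun=> 0).
  apply: compact_avg_inj => i; first by rewrite pc pc'.
  rewrite compact_avg_linear /compact_avg {1}fc {1}fc'.
  by rewrite !subrK mulN1r addNr.
apply/funext => i; apply/eqP; rewrite -subr_eq0 addrC -mulN1r.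
exact/eqP/d0.
Qed.

(** Surjectivity of [compact_avg] produces [g]; its injectivity then identifies the second
    component. *)
Lemma is_compactP f c : periodic_grid M f -> periodic_grid M c ->
  is_compact f c ->
  exists2 g, periodic_grid M g & f = compact_avg g /\ c = delta2_x h g.
Proof.
move=> pf pc fc; have [g pg gE] := compact_avg_solve pf.
exists g => //; split=> //; apply: is_compact_unique pc _ fc _.
  exact: periodic_delta2_x.
by rewrite gE; exact: compact_avg_is_compact.
Qed.

(** * One time step as a linear system *)

Section Step.
Variables (mu gamma kappa nu r : R) (U V : int -> R).
Implicit Types (a b P Q X Y : int -> R).

(* In both steps of the scheme the unknowns enter only through the averages
   [a], [b] of the old and new levels, the difference quotient being
   [r * (a - old)] with [r = 2 / tau] in the first step and [r = 1 / tau] in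
   the others. *)
Definition step_op a b i : R :=
  r * (a i - mu * b i)
  + gamma * (psi h U a i - h ^+ 2 / 2 * psi h V a i)
  + kappa * (Delta_x h a i - h ^+ 2 / 6 * Delta_x h b i) - nu * b i.

Lemma step_op_linear k a b a' b' i :
  step_op (fun j => k * a j + a' j) (fun j => k * b j + b' j) i
  = k * step_op a b i + step_op a' b' i.
Proof. by rewrite /step_op !psi_linear /Delta_x; field. Qed.

(** Bridge to the scheme: when [a], [b] are averages with the old level [P], [Q], the terms r (a -
    P) and r (b - Q) are its difference quotients. *)
Lemma step_op_residual a b P Q i :
  step_op a b i - r * (P i - mu * Q i) =
  r * (a i - P i) - mu * (r * (b i - Q i))
  + gamma * (psi h U a i - h ^+ 2 / 2 * psi h V a i)
  + kappa * (Delta_x h a i - h ^+ 2 / 6 * Delta_x h b i) - nu * b i.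
Proof. by rewrite /step_op; ring. Qed.

Hypotheses (pU : periodic_grid M U) (pV : periodic_grid M V).
Hypotheses (r_gt0 : 0 < r) (adm : 0 < mu + nu / r + h ^+ 2 / 6).

Lemma periodic_step_op a b : periodic_grid M a -> periodic_grid M b ->
  periodic_grid M (step_op a b).
Proof. by move=> pa pb; rewrite /step_op; periodic M. Qed.

Lemma step_op_inj c : periodic_grid M c ->
  step_op (compact_avg c) (delta2_x h c) =1 (fun=> 0) -> c =1 (fun=> 0).
Proof.
move=> pc op0; have pa := periodic_compact_avg pc.
have pb := periodic_delta2_x pc.
apply: (energy_definite pc adm); set A := sum _; set B := sum _.
suff E : r * (A + (mu + nu / r) * B) = 0.
  by move/eqP: E; rewrite mulf_eq0 gt_eqF //= => /eqP ->.
pose a := compact_avg c; pose b := delta2_x h c.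
have Da : sum (fun i => a i * Delta_x h a i) = 0 by apply: Delta_x_skew.
have Ua : sum (fun i => a i * psi h U a i) = 0 by apply: psi_skew.
have Va : sum (fun i => a i * psi h V a i) = 0 by apply: psi_skew.
(* Splitting a = c + (h^2/12) b reduces <a, Delta_x b> to [Dc] and [Db]. *)
have Db : sum (fun i => b i * Delta_x h b i) = 0 by apply: Delta_x_skew.
have Dc : sum (fun i => c i * Delta_x h b i) = 0.
  exact: Delta_x_delta2_x_skew.
transitivity (sum (fun i => a i * step_op a b i)); last first.
  by rewrite /period_sum big1 // => i _; rewrite op0 mulr0.
transitivity (r * (A + (mu + nu / r) * B)
    + gamma * (sum (fun i => a i * psi h U a i)
               - h ^+ 2 / 2 * sum (fun i => a i * psi h V a i))
    + kappa * (sum (fun i => a i * Delta_x h a i)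
               - h ^+ 2 / 6 * (sum (fun i => c i * Delta_x h b i)
                 + h ^+ 2 / 12 * sum (fun i => b i * Delta_x h b i)))).
  by rewrite Da Ua Va Db Dc; ring.
rewrite /A /B /period_sum.
do ?[rewrite mulr_sumr | rewrite -sumrN | rewrite -big_split /=].
apply: eq_bigr => i _; rewrite /step_op.
have -> : compact_avg c i = a i by [].
have -> : delta2_x h c i = b i by [].
have ac : c i = a i - h ^+ 2 / 12 * b i by rewrite /a /compact_avg addrK.
by rewrite ac; field; apply: lt0r_neq0.
Qed.

Lemma step_op_solve g : periodic_grid M g ->
  exists a b, [/\ periodic_grid M a, periodic_grid M b, is_compact a b
                & step_op a b =1 g].
Proof.
move=> pg; pose F c := step_op (compact_avg c) (delta2_x h c).
have Flin k u v i : F (fun j => k * u j + v j) i = k * F u i + F v i.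
  rewrite /F -step_op_linear; congr (step_op _ _ i); apply/funext => j.
    exact: compact_avg_linear.
  by rewrite /delta2_x; field.
have Fper f : periodic_grid M f -> periodic_grid M (F f).
  move=> pf; apply: periodic_step_op; first exact: periodic_compact_avg.
  exact: periodic_delta2_x.
have [c pc cE] := periodic_solve M_gt0 Flin Fper step_op_inj pg.
exists (compact_avg c), (delta2_x h c); split=> //.
- exact: periodic_compact_avg.
- exact: periodic_delta2_x.
- exact: compact_avg_is_compact.
Qed.

Lemma step_op_eq0 a b : periodic_grid M a -> periodic_grid M b ->
  is_compact a b -> step_op a b =1 (fun=> 0) ->
  a =1 (fun=> 0) /\ b =1 (fun=> 0).
Proof.
move=> pa pb ab op0; have [c pc [aE bE]] := is_compactP pa pb ab.
have c0 : c =1 (fun=> 0) by apply: step_op_inj => //; rewrite -aE -bE.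
by split=> i; rewrite ?aE ?bE /compact_avg /delta2_x !c0; field.
Qed.

Definition step_eq P Q X Y : Prop :=
  let a i := (P i + X i) / 2 in let b i := (Q i + Y i) / 2 in
  forall i, step_op a b i = r * (P i - mu * Q i).

Lemma step_exists P Q : periodic_grid M P -> periodic_grid M Q ->
  is_compact P Q ->
  exists X Y, [/\ periodic_grid M X, periodic_grid M Y, is_compact X Y
                & step_eq P Q X Y].
Proof.
move=> pP pQ PQ.
have pg : periodic_grid M (fun i => r * (P i - mu * Q i)).
  by move=> i; rewrite pP pQ.
have [a [b [pa pb ab abE]]] := step_op_solve pg.
(* The new level is the reflection of the old one in the average. *)
exists (fun i => 2 * a i - P i), (fun i => 2 * b i - Q i); split.
- by move=> i; rewrite pP pa.
- by move=> i; rewrite pQ pb.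
- by move=> i; rewrite {1}ab {1}PQ /delta2_x; field.
- by move=> i; rewrite -abE; congr (step_op _ _ i); apply/funext => j; field.
Qed.

Lemma step_unique P Q X Y X' Y' :
  periodic_grid M X -> periodic_grid M Y -> is_compact X Y ->
  periodic_grid M X' -> periodic_grid M Y' -> is_compact X' Y' ->
  step_eq P Q X Y -> step_eq P Q X' Y' -> X = X' /\ Y = Y'.
Proof.
move=> pX pY XY pX' pY' XY' eq1 eq2.
(* The old level cancels: half the difference of two solutions is the difference of their averages,
   and solves the homogeneous system. *)
have [] := @step_op_eq0 (fun i => (X i - X' i) / 2) (fun i => (Y i - Y' i) / 2).
- by move=> i; rewrite pX pX'.
- by move=> i; rewrite pY pY'.
- by move=> i; rewrite {1}XY {1}XY' /delta2_x; field.
- move=> i; transitivity (-1 * (r * (P i - mu * Q i)) + r * (P i - mu * Q i)).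
    rewrite -{1}eq2 -eq1 -step_op_linear.
    by congr (step_op _ _ i); apply/funext => j; field.
  by ring.
by move=> X0 Y0; split; apply/funext => i; [move: (X0 i) | move: (Y0 i)]; lra.
Qed.

End Step.

End SummationByParts.

(** * The scheme as a recursion on time levels *)

Section Scheme.
Variables (R : realType) (mu gamma kappa nu L T : R) (phi : R -> R) (M N : nat).
Hypotheses (L_gt0 : 0 < L) (T_gt0 : 0 < T).
Hypotheses (M_gt0 : (0 < M)%N) (N_gt0 : (0 < N)%N).

Let h := mesh_size L M.
Let tau := time_step T N.

Lemma mesh_size_gt0 : 0 < h.
Proof. by rewrite divr_gt0 ?ltr0n. Qed.

Lemma time_step_gt0 : 0 < tau.
Proof. by rewrite divr_gt0 ?ltr0n. Qed.

Let h_neq0 : h != 0. Proof. exact: lt0r_neq0 mesh_size_gt0. Qed.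
Let tau_neq0 : tau != 0. Proof. exact: lt0r_neq0 time_step_gt0. Qed.

Definition compact_pair (p : (int -> R) * (int -> R)) : Prop :=
  [/\ periodic_grid M p.1, periodic_grid M p.2 & is_compact h p.1 p.2].

Definition first_eq (p q : (int -> R) * (int -> R)) : Prop :=
  step_eq h mu gamma kappa nu (2 / tau) p.1 p.2 p.1 p.2 q.1 q.2.

(** Three consecutive levels: the coefficients come from the middle one, the averages from the outer
    two, so the equation is affine in [s]. *)
Definition next_eq (p q s : (int -> R) * (int -> R)) : Prop :=
  step_eq h mu gamma kappa nu tau^-1 q.1 q.2 p.1 p.2 s.1 s.2.

Lemma periodic_eqP f g : periodic_grid M f -> periodic_grid M g ->
  (forall i, 1 <= i <= M%:Z -> f i - g i = 0 :> R) <-> f =1 g.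
Proof.
move=> pf pg; split=> [fg|fg i _]; last by rewrite fg subrr.
apply: (periodic_grid_eq M_gt0 pf pg) => i /fg /eqP.
by rewrite subr_eq0 => /eqP.
Qed.

(** Periodicity extends the equations from 1..M to all integers, and [step_op_residual] matches
    their form. *)
Lemma compact_schemeP (u v : 'I_N.+1 -> int -> R) :
  let w k := (u (inord k), v (inord k)) in
  compact_scheme mu gamma kappa nu L T phi M u v <->
  [/\ forall k, (k <= N)%N -> compact_pair (w k),
      forall i, u ord0 i = phi (i%:~R * h),
      first_eq (w 0) (w 1)
    & forall k, (1 <= k <= N.-1)%N -> next_eq (w k.-1) (w k) (w k.+1)].
Proof.
move=> w.
have step_period r P Q X Y U V : compact_pair (P, Q) -> compact_pair (X, Y) ->
    compact_pair (U, V) ->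
    periodic_grid M (step_op h mu gamma kappa nu r U V
      (fun i => (P i + X i) / 2) (fun i => (Q i + Y i) / 2)) /\
    periodic_grid M (fun i => r * (P i - mu * Q i)).
  move=> [/= pP pQ _] [/= pX pY _] [/= pU pV _]; split; last first.
    by move=> i; rewrite pP pQ.
  by apply: periodic_step_op => // i; rewrite ?pP ?pX ?pQ ?pY.
have firstP : (forall k, compact_pair (u k, v k)) ->
    (forall i, 1 <= i <= M%:Z ->
      delta_t tau u 0 i - mu * delta_t tau v 0 i
      + gamma * (psi h (u ord0) (avg_half u 0) i
                 - h ^+ 2 / 2 * psi h (v ord0) (avg_half u 0) i)
      + kappa * (Delta_x h (avg_half u 0) i
                 - h ^+ 2 / 6 * Delta_x h (avg_half v 0) i)
      - nu * avg_half v 0 i = 0) <-> first_eq (w 0) (w 1).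
  move=> cw; have [pl pr] := step_period (2 / tau) _ _ _ _ _ _
    (cw (inord 0)) (cw (inord 1)) (cw (inord 0)).
  apply: iff_trans (periodic_eqP pl pr).
  have -> : ord0 = inord 0 :> 'I_N.+1 by apply: val_inj; rewrite /= inordK.
  have E (x : 'I_N.+1 -> int -> R) i :
      delta_t tau x 0 i
      = 2 / tau * (avg_half x 0 i - x (inord 0) i).
    by rewrite /delta_t /avg_half; field.
  by split=> H i /H; rewrite step_op_residual !E.
have nextP k : (forall k, compact_pair (u k, v k)) ->
    (forall i, 1 <= i <= M%:Z ->
      Delta_t tau u k i - mu * Delta_t tau v k i
      + gamma * (psi h (u (inord k)) (avg_bar u k) i
                 - h ^+ 2 / 2 * psi h (v (inord k)) (avg_bar u k) i)
      + kappa * (Delta_x h (avg_bar u k) i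
                 - h ^+ 2 / 6 * Delta_x h (avg_bar v k) i)
      - nu * avg_bar v k i = 0) <-> next_eq (w k.-1) (w k) (w k.+1).
  move=> cw; have [pl pr] := step_period tau^-1 _ _ _ _ _ _
    (cw (inord k.-1)) (cw (inord k.+1)) (cw (inord k)).
  apply: iff_trans (periodic_eqP pl pr).
  have E (x : 'I_N.+1 -> int -> R) i :
      Delta_t tau x k i
      = tau^-1 * (avg_bar x k i - x (inord k.-1) i).
    by rewrite /Delta_t /avg_bar; field.
  by split=> H i /H; rewrite step_op_residual !E.
split.
  move=> [pu pv init first step compact].
  have cw k : compact_pair (u k, v k).
    split=> //=; apply: (periodic_grid_eq M_gt0) (pv k) _ (compact k) => i.
    by rewrite !periodic_delta2_x ?pu ?pv.
  split=> // [k _||k kN]; [exact: cw | exact/(firstP cw) |].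
  by apply/(nextP k cw) => i iM; apply: step.
move=> [cw' init /= first step].
have cw k : compact_pair (u k, v k).
  by rewrite -[k]inord_val; apply: cw'; rewrite -ltnS.
split=> //.
- by move=> k; case: (cw k).
- by move=> k; case: (cw k).
- exact/(firstP cw).
- by move=> /= k i kN iM; apply: (nextP k cw).2 iM; apply: step.
- by move=> /= k i _; case: (cw k) => _ _; apply.
Qed.

Hypothesis mu_ge0 : 0 <= mu.
Hypothesis nu_adm : admissible_viscosity mu nu h tau.

Let next_adm : 0 < mu + nu / tau^-1 + h ^+ 2 / 6.
Proof. by rewrite invrK. Qed.

(** Here 1/r = tau/2, so this is the mean of mu + h^2/6, positive as [mu] is nonnegative, and the
    quantity made positive by [nu_adm]. *)
Let first_adm : 0 < mu + nu / (2 / tau) + h ^+ 2 / 6.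
Proof.
have h2 : 0 < h ^+ 2 by rewrite exprn_gt0 // mesh_size_gt0.
rewrite invf_div mulrA; move: nu_adm; rewrite /admissible_viscosity.
by move: mu_ge0; lra.
Qed.

Lemma first_eq_exists p : compact_pair p ->
  exists q, compact_pair q /\ first_eq p q.
Proof.
move=> [p1 p2 pc]; have r0 : 0 < 2 / tau by rewrite divr_gt0 ?time_step_gt0.
have [X [Y [pX pY XY eqXY]]] := step_exists mesh_size_gt0 M_gt0 gamma kappa
  p1 p2 r0 first_adm p1 p2 pc.
by exists (X, Y).
Qed.

Lemma next_eq_exists p q : compact_pair p -> compact_pair q ->
  exists s, compact_pair s /\ next_eq p q s.
Proof.
move=> [p1 p2 pc] [q1 q2 qc].
have r0 : 0 < tau^-1 by rewrite invr_gt0 time_step_gt0.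
have [X [Y [pX pY XY eqXY]]] := step_exists mesh_size_gt0 M_gt0 gamma kappa
  q1 q2 r0 next_adm p1 p2 pc.
by exists (X, Y).
Qed.

Lemma first_eq_unique p q q' : compact_pair p -> compact_pair q ->
  compact_pair q' -> first_eq p q -> first_eq p q' -> q = q'.
Proof.
move=> [p1 p2 pc] [q1 q2 qc] [q1' q2' qc'] eq1 eq2.
have r0 : 0 < 2 / tau by rewrite divr_gt0 ?time_step_gt0.
have [] := step_unique mesh_size_gt0 M_gt0 p1 p2 r0 first_adm
  q1 q2 qc q1' q2' qc' eq1 eq2.
by case: (q) (q') => [? ?] [? ?] /= -> ->.
Qed.

Lemma next_eq_unique p q s s' : compact_pair q -> compact_pair s ->
  compact_pair s' -> next_eq p q s -> next_eq p q s' -> s = s'.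
Proof.
move=> [q1 q2 qc] [s1 s2 sc] [s1' s2' sc'] eq1 eq2.
have r0 : 0 < tau^-1 by rewrite invr_gt0 time_step_gt0.
have [] := step_unique mesh_size_gt0 M_gt0 q1 q2 r0 next_adm
  s1 s2 sc s1' s2' sc' eq1 eq2.
by case: (s) (s') => [? ?] [? ?] /= -> ->.
Qed.

Lemma compact_trajectory p0 : compact_pair p0 ->
  exists w : nat -> (int -> R) * (int -> R),
    [/\ forall k, compact_pair (w k), w 0 = p0, first_eq (w 0) (w 1)
      & forall k, next_eq (w k) (w k.+1) (w k.+2)].
Proof.
move=> c0; have [p1 [c1 eq1]] := first_eq_exists c0.
have /choice[next nextP]
    (pq : ((int -> R) * (int -> R)) * ((int -> R) * (int -> R))) :
    exists s, compact_pair pq.1 -> compact_pair pq.2 ->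
      compact_pair s /\ next_eq pq.1 pq.2 s.
  (* [p0] is a dummy value that makes the choice function [next] total. *)
  have [cp|ncp] := pselect (compact_pair pq.1); last by exists p0.
  have [cq|ncq] := pselect (compact_pair pq.2); last by exists p0.
  by have [s sE] := next_eq_exists cp cq; exists s.
(* The state [z k] holds levels k and k+1. *)
pose z k := iter k (fun pq => (pq.2, next pq)) (p0, p1).
have cz k : compact_pair (z k).1 /\ compact_pair (z k).2.
  by elim: k => //= k [cp cq]; split=> //; case: (nextP _ cp cq).
exists (fun k => (z k).1); split=> // k; first by case: (cz k).
by case: (cz k) => cp cq; case: (nextP _ cp cq).
Qed.

End Scheme.

(** * Existence and uniqueness across all time levels *)

Theorem theorem2 (R : realType) (mu gamma kappa nu L T : R) (phi : R -> R)
    (M N : nat)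
    (mu_ge0 : 0 <= mu) (gamma_ge0 : 0 <= gamma)
    (L_gt0 : 0 < L) (T_gt0 : 0 < T)
    (phi_periodic : forall x : R, phi (x + L) = phi x)
    (M_gt0 : (0 < M)%N) (N_gt0 : (0 < N)%N)
    (nu_adm : admissible_viscosity mu nu (mesh_size L M) (time_step T N)) :
  exists! uv : ('I_N.+1 -> int -> R) * ('I_N.+1 -> int -> R),
    compact_scheme mu gamma kappa nu L T phi M uv.1 uv.2.
Proof.
have schemeP :=
  @compact_schemeP _ mu gamma kappa nu L T phi M N T_gt0 M_gt0 N_gt0.
have h_gt0 := mesh_size_gt0 L_gt0 M_gt0.
pose u0 (i : int) : R := phi (i%:~R * mesh_size L M).
have pu0 : periodic_grid M u0.
  move=> i; rewrite /u0 rmorphD mulrDl /= -[RHS]phi_periodic; congr (phi (_ + _)).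
  by rewrite /mesh_size mulrC divfK // pnatr_eq0 -lt0n.
(* The initial v is not prescribed: the compact relation forces it to be [delta2_x] of the [c] whose
   compact average is [u0]. *)
have [c pc u0E] := compact_avg_solve h_gt0 M_gt0 pu0.
have c0 : compact_pair L M (u0, delta2_x (mesh_size L M) c).
  split=> //=; first exact: periodic_delta2_x.
  by rewrite u0E; exact: compact_avg_is_compact.
have [w [cw w0 wfirst wnext]] :=
  compact_trajectory gamma kappa L_gt0 T_gt0 M_gt0 N_gt0 mu_ge0 nu_adm c0.
have ord0E : ord0 = inord 0 :> 'I_N.+1 by apply: val_inj; rewrite /= inordK.
pose u (k : 'I_N.+1) := (w k).1; pose v (k : 'I_N.+1) := (w k).2.
have wE k : (k <= N)%N -> (u (inord k), v (inord k)) = w k.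
  by move=> kN; rewrite /u /v inordK //; case: (w k).
have scheme_uv : compact_scheme mu gamma kappa nu L T phi M u v.
  apply/schemeP; split=> [k kN|i||k /andP[k1 kN]].
  - by rewrite wE.
  - by rewrite /u /= w0.
  - by rewrite !wE.
  - by rewrite !wE //; first (by have := wnext k.-1; rewrite prednK); lia.
exists (u, v); split=> // -[u' v'] /= scheme_uv'.
have [cu init first next] := (schemeP _ _).1 scheme_uv.
have [cu' init' first' next'] := (schemeP _ _).1 scheme_uv'.
have eq0 : (u (inord 0), v (inord 0)) = (u' (inord 0), v' (inord 0)).
  have [/= _ pv uv] := cu 0%N isT; have [/= _ pv' uv'] := cu' 0%N isT.
  have uE : u (inord 0) = u' (inord 0).
    by apply/funext => i; rewrite -ord0E init init'.
  rewrite uE; congr pair; apply: is_compact_unique pv pv' uv _ => //.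
  by rewrite uE.
(* The induction carries two consecutive levels, as the three-level step needs both predecessors. *)
have eqk k : (k < N)%N ->
    (u (inord k), v (inord k)) = (u' (inord k), v' (inord k)) /\
    (u (inord k.+1), v (inord k.+1)) = (u' (inord k.+1), v' (inord k.+1)).
  elim: k => [_|k IH kN].
    split=> //; apply: first_eq_unique (cu 0%N _) _ _ first _ => //.
    - exact: cu.
    - exact: cu'.
    - by move: first'; rewrite /= -eq0.
  have [e1 e2] := IH (ltnW kN); split=> //.
  have kN' : (1 <= k.+1 <= N.-1)%N by lia.
  apply: next_eq_unique (cu k.+1 _) _ _ (next k.+1 kN') _ => //.
  - exact: ltnW.
  - exact: cu.
  - exact: cu'.
  - by rewrite /= e1 e2; exact: next'.
have eq_all k : (k <= N)%N ->
    (u (inord k), v (inord k)) = (u' (inord k), v' (inord k)).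
  by case: k => [//|k kN]; case: (eqk k kN).
have eq_ord (k : 'I_N.+1) : (u k, v k) = (u' k, v' k).
  by rewrite -[k]inord_val; apply: eq_all; rewrite -ltnS.
by congr pair; apply/funext => k; case: (eq_ord k).
Qed.
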